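(* Let $\{\alpha,\beta\} \in \{\{132,231\},\ \{132,312\},\ \{213,231\},\ \{213,312\}\}$. Then $s_n(\emptyset;\{\alpha,\beta\}) = 2^{n-3}$ for all integers $n \geq 4$.
   Context: Let $S_n$ denote the set of permutations of $[n]=\{1,2,\dots,n\}$, written as words $\pi=\pi_1\pi_2\cdots\pi_n$. For a pattern $\alpha=\alpha_1\cdots\alpha_k \in S_k$ with $k \le n$, an occurrence of $\alpha$ in $\pi \in S_n$ is a choice of indices $i_1<i_2<\cdots<i_k$ such that $\pi_{i_1}\pi_{i_2}\cdots\pi_{i_k}$ is order-isomorphic to $\alpha$, i.e. $|\{m \in \{1,\dots,k\} : \pi_{i_m} \le \pi_{i_j}\}| = \alpha_j$ for every $j=1,\dots,k$. A permutation contains $\alpha$ exactly once if it has exactly one occurrence of $\alpha$. Patterns such as $132$ or $312$ are elements of $S_3$ written as words. For patterns $\alpha \neq \beta$ in $S_3$, $s_n(\emptyset;\{\alpha,\beta\})$ denotes the number of permutations $\pi \in S_n$ that contain exactly one occurrence of $\alpha$ and exactly one occurrence of $\beta$ (the symbol $\emptyset$ indicates that no pattern is required to be avoided). *)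

(* Defs.v *)
From mathcomp Require Import all_boot all_fingroup.

Set Implicit Arguments.
Unset Strict Implicit.
Unset Printing Implicit Defensive.

(* Positions and values of an element of 'S_n range over {0, ..., n - 1};
   [word] is the usual one-line notation, with values shifted to {1, ..., n}. *)
Definition word (n : nat) (s : 'S_n) : seq nat :=
  [seq (s i : nat).+1 | i <- enum 'I_n].

(* The choice of indices i_1 < ... < i_k is encoded as a strictly increasing
   finite function; the successor on the right-hand side is the value shift. *)
Definition is_occurrence (k n : nat) (a : 'S_k) (s : 'S_n)
    (f : {ffun 'I_k -> 'I_n}) : bool :=
  [forall i : 'I_k, forall j : 'I_k, (i < j) ==> (f i < f j)] &&
  [forall j : 'I_k, #|[set m : 'I_k | s (f m) <= s (f j)]| == (a j).+1].

Definition num_occurrences (k n : nat) (a : 'S_k) (s : 'S_n) : nat :=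
  #|[set f : {ffun 'I_k -> 'I_n} | is_occurrence a s f]|.

(* s_n(A; B): every pattern in A is avoided, and every pattern in B occurs
   exactly once. *)
Definition num_restricted (k n : nat) (A B : {set 'S_k}) : nat :=
  #|[set s : 'S_n | [forall a in A, num_occurrences a s == 0] &&
                    [forall b in B, num_occurrences b s == 1]]|.

(* The unordered pair {a, b} is the pair of permutations with words u and v. *)
Definition is_pattern_pair (k : nat) (a b : 'S_k) (u v : seq nat) : Prop :=
  (word a = u /\ word b = v) \/ (word a = v /\ word b = u).

(* Main.v *)
Require Import Defs.
From mathcomp Require Import all_boot all_fingroup.
From mathcomp Require Import zify.

(** Call a triple of positions p < i < q of a permutation s a peak when s i
    exceeds both s p and s q. A peak is an occurrence of 132 if s p < s q and
    of 231 if s p > s q, and every occurrence of 132 or 231 is a peak. So a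
    permutation with exactly one occurrence of each of them has exactly two
    peaks in all.

    Let the largest letter of s : 'S_n.+1 stand at position i. It has i letters
    on its left and n - i on its right, hence it is the middle of i * (n - i)
    peaks ([peak_bound]). When n >= 4 and 0 < i < n this number is at least 3,
    which is too many, so the largest letter is the first or the last one. At
    either end it takes part in no occurrence, because both patterns have their
    largest letter in the middle ([num_occurrences_end_max]). Removing it is
    therefore a two-to-one map onto the permutations of size n with the same
    property, and the count doubles from n to n + 1
    ([card_once_each_step]). In size 4 the two permutations are 2413 and 3142,
    which a computation over the 24 words confirms, and 2 * 2 ^ (n - 4) is
    2 ^ (n - 3).

    The other three pairs reduce to {132, 231} because numbers of occurrences
    are preserved when pattern and permutation are both reversed, both
    complemented, or both inverted: inversion carries {132, 312} to
    {132, 231}, reversal carries {213, 231} to {132, 312}, and complementation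
    carries {213, 312} to {132, 231}. *)

Set Implicit Arguments.
Unset Strict Implicit.
Unset Printing Implicit Defensive.

(** * Occurrences as order isomorphisms *)

Lemma card_le_ord k (j : 'I_k) : #|[set m : 'I_k | m <= j]| = j.+1.
Proof.
rewrite (_ : [set m | _] = widen_ord (ltn_ord j) @: [set: 'I_j.+1]).
  rewrite card_imset ?cardsT ?card_ord // => x y /(congr1 val) /= exy.
  exact: val_inj.
apply/setP=> m; rewrite inE; apply/idP/imsetP => [le_m|[x _ ->]].
  by exists (Ordinal (le_m : m < j.+1)); rewrite ?inE //; apply: val_inj.
by rewrite /= -ltnS ltn_ord.
Qed.

Lemma card_rank_perm k (a : 'S_k) (j : 'I_k) :
  #|[set m : 'I_k | a m <= a j]| = (a j).+1.
Proof.
rewrite -card_le_ord -[RHS](card_preimset _ (@perm_inj _ a)).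
by apply: eq_card => m; rewrite !inE.
Qed.

(** The rank condition of an occurrence says that s \o f and a order their
    indices alike: ranks grow strictly with the values of s \o f, and
    conversely the ranks of a permutation are its own values. In this symmetric
    form the conditions on positions and on values can be exchanged. *)
Lemma occurrenceP k n (a : 'S_k) (s : 'S_n) (f : {ffun 'I_k -> 'I_n}) :
  reflect ((forall i j, (f i < f j) = (i < j)) /\
           (forall i j, (s (f i) < s (f j)) = (a i < a j)))
          (is_occurrence a s f).
Proof.
apply: (iffP andP) => [[/forallP f_incr /forallP f_rank]|[f_incr f_iso]].
  have incr (i j : 'I_k) : i < j -> f i < f j.
    by move=> lt_ij; have /forallP/(_ j)/implyP := f_incr i; apply.
  have incrE (i j : 'I_k) : (f i < f j) = (i < j).
    case: (ltngtP i j) => [/incr //|/incr|/val_inj ->]; last by rewrite ltnn.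
    by move/ltnW; rewrite leqNgt => /negPf.
  split=> // i j.
  have f_inj : injective f.
    move=> x y exy; apply: val_inj; move: (incrE x y) (incrE y x).
    by rewrite exy ltnn; case: ltngtP.
  have up x y : s (f x) < s (f y) -> a x < a y.
    move=> lt_xy; rewrite -ltnS -(eqP (f_rank x)) -(eqP (f_rank y)).
    (* The lower set of x is strictly inside that of y, which contains y. *)
    apply/proper_card/properP; split.
      by apply/subsetP=> m; rewrite !inE => /leq_trans; apply; apply: ltnW.
    by exists y; rewrite !inE ?leqnn // -ltnNge.
  case: (ltngtP (s (f i)) (s (f j))) => [/up //|/up|].
    by move/ltnW; rewrite leqNgt => /negPf.
  by move/val_inj/perm_inj/f_inj ->; rewrite ltnn.
split; first by apply/forallP=> i; apply/forallP=> j; rewrite f_incr implybb.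
apply/forallP=> j; rewrite -card_rank_perm; apply/eqP/eq_card => m.
by rewrite !inE leqNgt f_iso -leqNgt.
Qed.

Lemma num_occurrences_leq k n n' (a a' : 'S_k) (s : 'S_n) (s' : 'S_n')
    (F : {ffun 'I_k -> 'I_n} -> {ffun 'I_k -> 'I_n'}) :
    injective F ->
    (forall f, is_occurrence a s f -> is_occurrence a' s' (F f)) ->
  num_occurrences a s <= num_occurrences a' s'.
Proof.
move=> F_inj F_occ; rewrite /num_occurrences -(card_imset _ F_inj).
apply/subset_leq_card/subsetP=> _ /imsetP[f + ->]; rewrite !inE; exact: F_occ.
Qed.

(** * The dihedral symmetries of pattern containment *)

Definition rev_perm n : 'S_n := perm (@rev_ord_inj n).

Lemma rev_permK n : (rev_perm n * rev_perm n = 1)%g.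
Proof. by apply/permP=> i; rewrite permM !permE rev_ordK. Qed.

Lemma ltn_rev_perm n (i j : 'I_n) : (rev_perm n i < rev_perm n j) = (j < i).
Proof. rewrite !permE /=; have := ltn_ord i; have := ltn_ord j; lia. Qed.

(** Only an inequality has to be checked in this lemma and in the next two:
    each symmetry is an involution, so applying the inequality to the image
    gives the opposite one.

    The product of permutations composes from left to right, so multiplying by
    [rev_perm] on the left reverses a word, and on the right complements it. *)
Lemma num_occurrences_rev k n (a : 'S_k) (s : 'S_n) :
  num_occurrences (rev_perm k * a)%g (rev_perm n * s)%g = num_occurrences a s.
Proof.
have le_rev (b : 'S_k) (t : 'S_n) :
    num_occurrences b t <= num_occurrences (rev_perm k * b)%g (rev_perm n * t)%g.
  pose F (f : {ffun 'I_k -> 'I_n}) := [ffun i => rev_perm n (f (rev_perm k i))].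
  apply: (num_occurrences_leq (F := F)) => [f g /ffunP Efg|f].
    apply/ffunP=> i; move: (Efg (rev_perm k i)).
    by rewrite !ffunE -permM rev_permK perm1 => /perm_inj.
  case/occurrenceP=> f_incr f_iso; apply/occurrenceP.
  split=> i j; rewrite !ffunE; first by rewrite ltn_rev_perm f_incr ltn_rev_perm.
  by rewrite -!permM !(mulgA (rev_perm n)) rev_permK mul1g f_iso !permM.
apply/eqP; rewrite eqn_leq le_rev andbT.
have := le_rev (rev_perm k * a)%g (rev_perm n * s)%g.
by rewrite !mulgA !rev_permK !mul1g.
Qed.

Lemma num_occurrences_compl k n (a : 'S_k) (s : 'S_n) :
  num_occurrences (a * rev_perm k)%g (s * rev_perm n)%g = num_occurrences a s.
Proof.
have le_compl (b : 'S_k) (t : 'S_n) :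
    num_occurrences b t <= num_occurrences (b * rev_perm k)%g (t * rev_perm n)%g.
  apply: (num_occurrences_leq (F := id)) => // f /occurrenceP[f_incr f_iso].
  by apply/occurrenceP; split=> // i j; rewrite !permM !ltn_rev_perm.
apply/eqP; rewrite eqn_leq le_compl andbT.
have := le_compl (a * rev_perm k)%g (s * rev_perm n)%g.
by rewrite -!mulgA !rev_permK !mulg1.
Qed.

Lemma num_occurrences_inv k n (a : 'S_k) (s : 'S_n) :
  num_occurrences a^-1%g s^-1%g = num_occurrences a s.
Proof.
have le_inv (b : 'S_k) (t : 'S_n) :
    num_occurrences b t <= num_occurrences b^-1%g t^-1%g.
  (* Inversion swaps positions and values: the positions of the new occurrence
     are the values of the old one, listed in increasing order by b^-1. *)
  pose F (f : {ffun 'I_k -> 'I_n}) := [ffun i => t (f (b^-1%g i))].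
  apply: (num_occurrences_leq (F := F)) => [f g /ffunP Efg|f].
    apply/ffunP=> i; move: (Efg (b i)).
    by rewrite !ffunE permK => /perm_inj.
  case/occurrenceP=> f_incr f_iso; apply/occurrenceP.
  by split=> i j; rewrite !ffunE ?f_iso ?permKV ?permK ?f_incr.
apply/eqP; rewrite eqn_leq le_inv andbT.
by have := le_inv a^-1%g s^-1%g; rewrite !invgK.
Qed.

(** * Inserting a letter *)

Lemma ltn_lift n (h : 'I_n.+1) (i j : 'I_n) : (lift h i < lift h j) = (i < j).
Proof. rewrite /= /bump; lia. Qed.

(** [lift_perm i j s] inserts the value j at position i of s. The occurrences
    that avoid position i are exactly the images of the occurrences in s under
    the increasing map [lift i]. *)
Lemma num_occurrences_lift_perm k n (a : 'S_k) (i j : 'I_n.+1) (s : 'S_n) :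
    (forall f, is_occurrence a (lift_perm i j s) f -> forall m, f m != i) ->
  num_occurrences a (lift_perm i j s) = num_occurrences a s.
Proof.
move=> avoid_i; pose F (f : {ffun 'I_k -> 'I_n}) := [ffun m => lift i (f m)].
have F_inj : injective F.
  move=> f g /ffunP Efg; apply/ffunP=> m; move: (Efg m).
  by rewrite !ffunE => /lift_inj.
have F_occ f : is_occurrence a (lift_perm i j s) (F f) = is_occurrence a s f.
  by apply/occurrenceP/occurrenceP; case=> f_incr f_iso; split=> x y;
     move: (f_incr x y) (f_iso x y); rewrite !ffunE ?lift_perm_lift !ltn_lift.
rewrite /num_occurrences -[RHS](card_imset _ F_inj); apply: eq_card => f.
apply/idP/imsetP => [|[g]]; last by rewrite !inE => occ_g ->; rewrite F_occ.
rewrite !inE => occ_f.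
have unl m : {x | f m = lift i x}.
  case: (unliftP i (f m)) => [x ->|/eqP]; first by exists x.
  by rewrite (negPf (avoid_i f occ_f m)).
have Ef : f = F [ffun m => sval (unl m)].
  by apply/ffunP=> m; rewrite !ffunE; case: (unl m).
by exists [ffun m => sval (unl m)]; rewrite // inE -F_occ -Ef.
Qed.

Lemma lift_perm_inj n (i j : 'I_n.+1) : injective (@lift_perm n i j).
Proof.
move=> s t /permP Est; apply/permP=> m; move: (Est (lift i m)).
by rewrite !lift_perm_lift => /lift_inj.
Qed.

Lemma lift_perm_surj n (i j : 'I_n.+1) (t : 'S_n.+1) :
  t i = j -> exists s, t = lift_perm i j s.
Proof.
move=> ti; have unl m : {x | t (lift i m) = lift j x}.
  case: (unliftP j (t (lift i m))) => [x ->|]; first by exists x.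
  by rewrite -ti => /perm_inj/eqP; rewrite eq_sym (negPf (neq_lift i m)).
have unl_inj : injective (fun m => sval (unl m)).
  move=> x y /=; case: (unl x) (unl y) => [u Eu] [v Ev] /= Euv.
  by apply: (@lift_inj _ i); apply: (@perm_inj _ t); rewrite Eu Ev Euv.
exists (perm unl_inj); apply/permP=> m.
case: (unliftP i m) => [x|] ->; last by rewrite lift_perm_id.
by rewrite lift_perm_lift permE; case: (unl x).
Qed.

Definition interior_max k (a : 'S_k.+1) :=
  (a ord0 != ord_max) && (a ord_max != ord_max).

(** If a m were not the largest letter of a, the letter of s that plays the
    largest one would exceed the largest letter of s. *)
Lemma occurrence_max k n (a : 'S_k.+1) (s : 'S_n.+1) f m :
  is_occurrence a s f -> s (f m) = ord_max -> a m = ord_max.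
Proof.
case/occurrenceP=> _ f_iso sm; apply/eqP; apply: contraT => am.
have: a m < a (a^-1%g ord_max).
  by rewrite permKV /= ltn_neqAle -ltnS ltn_ord andbT -(inj_eq val_inj) in am *.
by rewrite -f_iso sm ltnNge -ltnS ltn_ord.
Qed.

Lemma occurrence_first k n (a : 'S_k.+1) (s : 'S_n.+1) f m :
  is_occurrence a s f -> f m = ord0 -> m = ord0.
Proof.
case/occurrenceP=> f_incr _ fm; apply/eqP; apply: contraT => m0.
have: @ord0 k < m by rewrite lt0n.
by rewrite -f_incr fm.
Qed.

Lemma occurrence_last k n (a : 'S_k.+1) (s : 'S_n.+1) f m :
  is_occurrence a s f -> f m = ord_max -> m = ord_max.
Proof.
case/occurrenceP=> f_incr _ fm; apply/eqP; apply: contraT => mk.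
have: m < @ord_max k by rewrite ltn_neqAle -ltnS ltn_ord andbT.
by rewrite -f_incr fm ltnNge -ltnS ltn_ord.
Qed.

(** An occurrence using the new letter would let it play the largest letter of
    a, being the largest letter, and also the first or the last letter of a,
    because it stands at an end. *)
Lemma num_occurrences_end_max k n (a : 'S_k.+1) (i : 'I_n.+1) (s : 'S_n) :
    interior_max a -> i \in [set ord0; ord_max] ->
  num_occurrences a (lift_perm i ord_max s) = num_occurrences a s.
Proof.
case/andP=> a0 ak i_end; apply: num_occurrences_lift_perm => f occ_f m.
apply: contraTneq i_end => fm; rewrite !inE.
have am : a m = ord_max by apply: occurrence_max occ_f _; rewrite fm lift_perm_id.
apply/norP; split; apply/eqP=> Ei; rewrite Ei in fm.
  by move: a0; rewrite -am (occurrence_first occ_f fm) eqxx.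
by move: ak; rewrite -{2}am (occurrence_last occ_f fm) eqxx.
Qed.

(** * Patterns of length three, computed on words *)

Definition triple n (p q r : 'I_n) : {ffun 'I_3 -> 'I_n} :=
  [ffun i : 'I_3 => nth p [:: p; q; r] i].

Definition ord3 (m : nat) : 'I_3 := inord m.

Lemma forall_ord3 (P : 'I_3 -> Prop) :
  P (ord3 0) -> P (ord3 1) -> P (ord3 2) -> forall i, P i.
Proof.
move=> P0 P1 P2 [[|[|[|//]]] lt_i].
- by rewrite (_ : Ordinal lt_i = ord3 0) //; apply: val_inj; rewrite /= inordK.
- by rewrite (_ : Ordinal lt_i = ord3 1) //; apply: val_inj; rewrite /= inordK.
- by rewrite (_ : Ordinal lt_i = ord3 2) //; apply: val_inj; rewrite /= inordK.
Qed.

Lemma word3E (a : 'S_3) :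
  word a = [:: (a (ord3 0)).+1; (a (ord3 1)).+1; (a (ord3 2)).+1].
Proof.
rewrite /word (_ : enum 'I_3 = [seq ord3 m | m <- iota 0 3]) //.
apply: (inj_map val_inj); rewrite val_enum_ord.
by rewrite /= !inordK.
Qed.

Lemma tripleE n (f : {ffun 'I_3 -> 'I_n}) :
  f = triple (f (ord3 0)) (f (ord3 1)) (f (ord3 2)).
Proof. by apply/ffunP; apply: forall_ord3; rewrite !ffunE inordK. Qed.

Lemma triple_inj n (p q r p' q' r' : 'I_n) :
  triple p q r = triple p' q' r' -> [/\ p = p', q = q' & r = r'].
Proof.
move=> /ffunP E.
by split; [move: (E (ord3 0)) | move: (E (ord3 1)) | move: (E (ord3 2))];
   rewrite !ffunE !inordK.
Qed.

Definition isomorphic3 (x y z x' y' z' : nat) :=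
  [&& (x < y) == (x' < y'), (y < z) == (y' < z') & (x < z) == (x' < z')].

Lemma occurrence_triple n (a : 'S_3) (s : 'S_n) (p q r : 'I_n) :
  is_occurrence a s (triple p q r) =
  [&& p < q, q < r & isomorphic3 (s p) (s q) (s r)
                                 (a (ord3 0)) (a (ord3 1)) (a (ord3 2))].
Proof.
have [t0 t1 t2] : [/\ triple p q r (ord3 0) = p, triple p q r (ord3 1) = q
                    & triple p q r (ord3 2) = r].
  by split; rewrite ffunE inordK.
have aneq (i j : 'I_3) : i <> j -> nat_of_ord (a i) <> a j.
  by move=> nij /val_inj/perm_inj.
have n01 : ord3 0 <> ord3 1 by move/(congr1 val); rewrite /= !inordK.
have n02 : ord3 0 <> ord3 2 by move/(congr1 val); rewrite /= !inordK.
have n12 : ord3 1 <> ord3 2 by move/(congr1 val); rewrite /= !inordK.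
apply/occurrenceP/and3P.
  case=> f_incr f_iso.
  have := f_incr (ord3 0) (ord3 1); have := f_incr (ord3 1) (ord3 2).
  have := f_iso (ord3 0) (ord3 1); have := f_iso (ord3 1) (ord3 2).
  have := f_iso (ord3 0) (ord3 2).
  rewrite /isomorphic3 !t0 !t1 !t2 !inordK // => -> -> -> -> ->.
  by rewrite !eqxx.
case=> lt_pq lt_qr /and3P[/eqP E01 /eqP E12 /eqP E02].
have sneq (i j : 'I_n) : i < j -> nat_of_ord (s i) <> s j.
  by move=> + /val_inj/perm_inj Eij; rewrite Eij ltnn.
have := aneq _ _ n01; have := aneq _ _ n02; have := aneq _ _ n12.
have := sneq _ _ lt_pq; have := sneq _ _ lt_qr.
have := sneq _ _ (ltn_trans lt_pq lt_qr).
move=> ? ? ? ? ? ?.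
split; apply: forall_ord3; apply: forall_ord3; rewrite ?t0 ?t1 ?t2 ?inordK //; lia.
Qed.

Definition count_triples (u w : seq nat) : nat :=
  \sum_(0 <= p < size w) \sum_(0 <= q < size w) \sum_(0 <= r < size w)
    [&& p < q, q < r & isomorphic3 (nth 0 w p) (nth 0 w q) (nth 0 w r)
                                   (nth 0 u 0) (nth 0 u 1) (nth 0 u 2)].

Lemma size_word n (s : 'S_n) : size (word s) = n.
Proof. by rewrite size_map size_enum_ord. Qed.

Lemma nth_word n (s : 'S_n) (i : 'I_n) : nth 0 (word s) i = (s i).+1.
Proof. by rewrite (nth_map i) ?size_enum_ord // nth_ord_enum. Qed.

(** Unlike the cardinal of a set of finite functions, the right-hand side
    evaluates on concrete words. *)
Lemma num_occurrences_word n (a : 'S_3) (s : 'S_n) :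
  num_occurrences a s = count_triples (word a) (word s).
Proof.
rewrite /count_triples size_word big_mkord.
under eq_bigr do rewrite big_mkord.
under eq_bigr do under eq_bigr do rewrite big_mkord.
under eq_bigr do rewrite pair_big /=.
rewrite pair_big /= /num_occurrences -sum1_card big_mkcond /=.
rewrite (reindex (fun t : 'I_n * ('I_n * 'I_n) => triple t.1 t.2.1 t.2.2)) /=.
  apply: eq_bigr => [[p [q r]]] _ /=.
  rewrite inE occurrence_triple word3E !nth_word /= /isomorphic3 !ltnS.
  by case: [&& _, _ & _].
apply: onW_bij.
exists (fun f : {ffun 'I_3 -> 'I_n} => (f (ord3 0), (f (ord3 1), f (ord3 2)))).
  by move=> [p [q r]]; rewrite /= !ffunE !inordK.
by move=> f /=; rewrite -tripleE.
Qed.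

Lemma word_inj n : injective (@word n).
Proof.
move=> s t Est; apply/permP=> i; apply: val_inj; apply: succn_inj.
by rewrite -!nth_word Est.
Qed.

Lemma word_permutations n (s : 'S_n) : word s \in permutations (iota 1 n).
Proof.
rewrite mem_permutations uniq_perm ?iota_uniq //.
  by rewrite map_inj_uniq ?enum_uniq // => i j [] /val_inj/perm_inj.
move=> m; rewrite mem_iota add1n; apply/mapP/idP => [[i _ ->]|].
  by rewrite /= ltnS ltn_ord.
case: m => // m lt_m; exists (s^-1%g (Ordinal (lt_m : m < n))).
  by rewrite mem_enum.
by rewrite permKV.
Qed.

(** [word] is a bijection onto the permutations of the list 1, ..., n: it is
    injective, and there are n! objects on both sides. *)
Lemma card_word n (P : pred (seq nat)) :
  #|[set s : 'S_n | P (word s)]| = count P (permutations (iota 1 n)).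
Proof.
have ws_uniq : uniq [seq word s | s <- enum 'S_n].
  by rewrite map_inj_uniq ?enum_uniq //; apply: word_inj.
have [||_ Ews] := uniq_min_size (s2 := permutations (iota 1 n)) ws_uniq.
- by move=> _ /mapP[s _ ->]; apply: word_permutations.
- by rewrite size_permutations ?iota_uniq // size_iota size_map -cardE card_Sn.
rewrite -(seq.permP (uniq_perm ws_uniq (permutations_uniq _) Ews)).
rewrite cardsE cardE /enum_mem size_filter count_map count_filter.
by apply: eq_count => s; rewrite /= andbT.
Qed.

Lemma word_compl n (s : 'S_n) :
  word (s * rev_perm n)%g = [seq n.+1 - m | m <- word s].
Proof.
rewrite /word -map_comp; apply: eq_map => i /=.
rewrite permM !permE /=; have := ltn_ord (s i); lia.
Qed.

Lemma word_rev n (s : 'S_n) : word (rev_perm n * s)%g = rev (word s).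
Proof.
apply: (@eq_from_nth _ 0); rewrite ?size_rev !size_word // => m lt_m.
rewrite nth_rev size_word // -[m]/(val (Ordinal lt_m)) nth_word permM.
by rewrite -nth_word permE.
Qed.

Lemma word_inv n (s : 'S_n) :
  word s^-1%g = [seq (index v (word s)).+1 | v <- iota 1 n].
Proof.
apply: (@eq_from_nth _ 0); rewrite size_word ?size_map ?size_iota // => m lt_m.
rewrite (nth_map 0) ?size_iota // nth_iota // -[m]/(val (Ordinal lt_m)) nth_word.
have := word_permutations s; rewrite mem_permutations => /perm_uniq.
rewrite iota_uniq => w_uniq; set i := Ordinal lt_m.
have -> : 1 + m = nth 0 (word s) (s^-1%g i) by rewrite nth_word permKV.
by rewrite index_uniq ?size_word.
Qed.

(** * Permutations containing two patterns exactly once each *)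

Definition once_each k (a b : 'S_k) n : {set 'S_n} :=
  [set s | (num_occurrences a s == 1) && (num_occurrences b s == 1)].

Lemma num_restricted_once_each k (a b : 'S_k) n :
  num_restricted n set0 [set a; b] = #|once_each a b n|.
Proof.
apply: eq_card => s; rewrite !inE.
have -> /= : [forall c in set0, num_occurrences (c : 'S_k) s == 0].
  by apply/forall_inP=> c; rewrite inE.
apply/forall_inP/andP => [once|[a1 b1] c].
  by rewrite !once // !inE eqxx ?orbT.
by rewrite !inE => /orP[]/eqP->.
Qed.

Lemma once_eachC k (a b : 'S_k) n : once_each a b n = once_each b a n.
Proof. by apply/setP=> s; rewrite !inE andbC. Qed.

(** The form in which a symmetry of containment acts: [phi] moves the
    permutations, and a', b' are the images of the patterns a, b. *)
Lemma card_once_each_transport k (a b a' b' : 'S_k) n (phi : 'S_n -> 'S_n) :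
    injective phi ->
    (forall s, num_occurrences a' (phi s) = num_occurrences a s) ->
    (forall s, num_occurrences b' (phi s) = num_occurrences b s) ->
  #|once_each a b n| = #|once_each a' b' n|.
Proof.
move=> phi_inj a_phi b_phi; rewrite -[RHS](card_preimset _ phi_inj).
by apply: eq_card => s; rewrite !inE a_phi b_phi.
Qed.

(** * The pair {132, 231} *)

(** Each choice of a position before i and of a position after i gives a peak,
    whose type depends on which of its outer letters is larger. *)
Lemma peak_bound (a b : 'S_3) n (s : 'S_n.+1) i :
    word a = [:: 1; 3; 2] -> word b = [:: 2; 3; 1] ->
  s i = ord_max -> i * (n - i) <= num_occurrences a s + num_occurrences b s.
Proof.
move=> wa wb si; set L := [set p : 'I_n.+1 | p < i].
set R := [set q : 'I_n.+1 | i < q].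
have cR : #|R| = n - i.
  rewrite (_ : R = ~: [set q : 'I_n.+1 | q <= i]); last first.
    by apply/setP=> q; rewrite !inE ltnNge.
  rewrite -[LHS](addKn #|[set q : 'I_n.+1 | q <= i]|) cardsC card_le_ord.
  by rewrite card_ord subSS.
have cL : #|L| = i.
  apply/succn_inj; rewrite -card_le_ord [RHS](cardsD1 i) inE leqnn add1n; congr _.+1.
  by apply: eq_card => p; rewrite !inE -(inj_eq val_inj) ltn_neqAle.
rewrite -cR -{1}cL -cardsX.
pose F (x : 'I_n.+1 * 'I_n.+1) := triple x.1 i x.2.
have F_inj : injective F by move=> [p q] [p' q'] /triple_inj[/= -> _ ->].
rewrite -(card_imset _ F_inj).
apply: leq_trans (leq_card_setU _ _).
apply/subset_leq_card/subsetP=> _ /imsetP[[p q] + ->].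
rewrite !inE /= => /andP[lt_pi lt_iq]; rewrite !occurrence_triple lt_pi lt_iq /=.
move: wa wb; rewrite !word3E => -[-> -> ->] [-> -> ->].
have nmax j : j != i -> s j < s i.
  move=> ji; rewrite si ltn_neqAle -ltnS ltn_ord andbT (inj_eq val_inj) -si.
  by rewrite (inj_eq perm_inj).
have pi : s p < s i by apply: nmax; rewrite -(inj_eq val_inj) ltn_eqF.
have qi : s q < s i by apply: nmax; rewrite -(inj_eq val_inj) gtn_eqF.
have : nat_of_ord (s p) <> s q.
  by move/val_inj/perm_inj=> Epq; rewrite Epq in lt_pi; lia.
rewrite /isomorphic3; lia.
Qed.

Lemma interior_max_132_231 (a b : 'S_3) :
    word a = [:: 1; 3; 2] -> word b = [:: 2; 3; 1] ->
  interior_max a && interior_max b.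
Proof.
have E0 : ord3 0 = ord0 by apply: val_inj; rewrite /= inordK.
have E2 : ord3 2 = ord_max by apply: val_inj; rewrite /= inordK.
rewrite !word3E E0 E2 /interior_max -!(inj_eq val_inj) /=.
by case=> -> _ -> [-> _ ->].
Qed.

Lemma card_once_each_step (a b : 'S_3) n :
    word a = [:: 1; 3; 2] -> word b = [:: 2; 3; 1] -> 4 <= n ->
  #|once_each a b n.+1| = 2 * #|once_each a b n|.
Proof.
move=> wa wb n4; have [inta intb] := andP (interior_max_132_231 wa wb).
have occ_end (i : 'I_n.+1) (s : 'S_n) : i \in [set ord0; ord_max] ->
    (lift_perm i ord_max s \in once_each a b n.+1) = (s \in once_each a b n).
  by move=> i_end; rewrite !inE !num_occurrences_end_max.
pose ins (i : 'I_n.+1) := lift_perm i ord_max @: once_each a b n.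
have -> : once_each a b n.+1 = ins ord0 :|: ins ord_max.
  apply/setP=> t; apply/idP/setUP => [t_in|]; last first.
    by case=> /imsetP[s s_in ->]; rewrite occ_end // !inE eqxx ?orbT.
  pose i := t^-1%g ord_max; have ti : t i = ord_max by rewrite permKV.
  have [s Et] := lift_perm_surj ti.
  have [i_end|] := boolP (i \in [set ord0; ord_max]).
    have s_in : t \in ins i by rewrite Et imset_f // -(occ_end i) // -Et.
    by move: i_end s_in; rewrite !inE => /orP[]/eqP->; [left|right].
  rewrite !inE -!(inj_eq val_inj) /= => /norP[i0 in_].
  (* As 0 < i < n and 4 <= n, the product i * (n - i) is at least 3. *)
  have := peak_bound wa wb ti; have := ltn_ord i; move: t_in.
  rewrite inE => /andP[/eqP-> /eqP->]; nia.
have ins_card i : #|ins i| = #|once_each a b n| by apply/card_imset/lift_perm_inj.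
have -> : #|ins ord0 :|: ins ord_max| = #|ins ord0| + #|ins ord_max|.
  rewrite cardsU (_ : _ :&: _ = set0) ?cards0 ?subn0 //.
  apply/setP=> t; rewrite !inE; apply/andP=> -[/imsetP[s _ ->] /imsetP[s' _ Es]].
  have : lift_perm ord0 ord_max s ord0 = lift_perm ord0 ord_max s ord_max.
    by rewrite {2}Es !lift_perm_id.
  by move/perm_inj/(congr1 val) => /= n0; rewrite -n0 in n4.
by rewrite !ins_card mul2n addnn.
Qed.

Lemma card_once_each_4 (a b : 'S_3) :
    word a = [:: 1; 3; 2] -> word b = [:: 2; 3; 1] ->
  #|once_each a b 4| = 2.
Proof.
move=> wa wb; pose P w :=
  (count_triples [:: 1; 3; 2] w == 1) && (count_triples [:: 2; 3; 1] w == 1).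
have -> : once_each a b 4 = [set s | P (word s)].
  by apply/setP=> s; rewrite !inE !num_occurrences_word wa wb.
by rewrite card_word /P /count_triples unlock; vm_compute.
Qed.

Lemma card_once_each_132_231 (a b : 'S_3) n :
    word a = [:: 1; 3; 2] -> word b = [:: 2; 3; 1] -> 4 <= n ->
  #|once_each a b n| = 2 ^ (n - 3).
Proof.
move=> wa wb; elim: n => // n IHn; rewrite leq_eqVlt => /predU1P[<-|n4].
  exact: card_once_each_4.
by rewrite card_once_each_step // IHn // -expnS subSn // ltnW.
Qed.

(** * The other pairs *)

Lemma card_once_each_132_312 (a b : 'S_3) n :
    word a = [:: 1; 3; 2] -> word b = [:: 3; 1; 2] -> 4 <= n ->
  #|once_each a b n| = 2 ^ (n - 3).
Proof.
move=> wa wb n4.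
rewrite (card_once_each_transport (@invg_inj _)
           (num_occurrences_inv a) (num_occurrences_inv b)).
by apply: card_once_each_132_231; rewrite // word_inv ?wa ?wb.
Qed.

Lemma card_once_each_compl k (a b : 'S_k) n :
  #|once_each a b n| =
  #|once_each (a * rev_perm k)%g (b * rev_perm k)%g n|.
Proof.
apply: card_once_each_transport (mulIg (rev_perm n)) _ _ => s;
  exact: num_occurrences_compl.
Qed.

Lemma card_once_each_rev k (a b : 'S_k) n :
  #|once_each a b n| =
  #|once_each (rev_perm k * a)%g (rev_perm k * b)%g n|.
Proof.
apply: card_once_each_transport (mulgI (rev_perm n)) _ _ => s;
  exact: num_occurrences_rev.
Qed.

Theorem theorem5p4 (alpha beta : 'S_3)
    (hpair : is_pattern_pair alpha beta [:: 1; 3; 2] [:: 2; 3; 1] \/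
             is_pattern_pair alpha beta [:: 1; 3; 2] [:: 3; 1; 2] \/
             is_pattern_pair alpha beta [:: 2; 1; 3] [:: 2; 3; 1] \/
             is_pattern_pair alpha beta [:: 2; 1; 3] [:: 3; 1; 2])
    (n : nat) (hn : 4 <= n) :
  num_restricted n set0 [set alpha; beta] = 2 ^ (n - 3).
Proof.
have ordered (a b : 'S_3) u v : is_pattern_pair a b u v ->
    (forall c d : 'S_3, word c = u -> word d = v ->
       #|once_each c d n| = 2 ^ (n - 3)) ->
    #|once_each a b n| = 2 ^ (n - 3).
  by case=> -[wa wb] ordered_case; [|rewrite once_eachC]; apply: ordered_case.
rewrite num_restricted_once_each.
case: hpair => [|[|[|]]] /ordered; apply=> c d wc wd.
- exact: card_once_each_132_231.
- exact: card_once_each_132_312.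
- rewrite card_once_each_rev once_eachC.
  by apply: card_once_each_132_312; rewrite ?word_rev ?wc ?wd.
rewrite card_once_each_compl once_eachC.
by apply: card_once_each_132_231; rewrite ?word_compl ?wc ?wd.
Qed.
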